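(* Let $L\in\mathbb{Z}_{\ge2}$ and $N,P>0$ with $\frac NP\le\frac{L-1}{L}$. Then $C_{L-1}(P,N)\le\frac12\ln\frac{(L-1)P}{LN}$.
   Context: $\mathcal{B}^n(y,r)$ is the closed Euclidean ball of radius $r$ centered at $y$, $\mathcal{B}^n(r)=\mathcal{B}^n(0,r)$. A finite $\mathcal{C}\subseteq\mathcal{B}^n(\sqrt{nP})$ is $(P,N,L-1)$-list-decodable (a $(P,N,L-1)$-multiple packing) if $|\mathcal{C}\cap\mathcal{B}^n(y,\sqrt{nN})|\le L-1$ for every $y\in\mathbb{R}^n$. Rate $R(\mathcal{C})=\frac1n\ln|\mathcal{C}|$. $C_{L-1}(P,N)=\limsup_{n\to\infty}\sup R(\mathcal{C})$ over all $(P,N,L-1)$-list-decodable $\mathcal{C}\subseteq\mathcal{B}^n(\sqrt{nP})$. *)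

(* Defs.v *)
From mathcomp Require Import all_boot all_order all_algebra.
From mathcomp Require Import all_classical all_reals all_analysis.
Set Implicit Arguments. Unset Strict Implicit. Unset Printing Implicit Defensive.
Import Order.TTheory GRing.Theory Num.Theory.
Local Open Scope ring_scope.
Local Open Scope classical_set_scope.

Section Defs.
Variable R : realType.

Definition enorm (n : nat) (x : 'rV[R]_n) : R :=
  Num.sqrt (\sum_(i < n) x 0 i ^+ 2).

Definition eball (n : nat) (y : 'rV[R]_n) (r : R) : set 'rV[R]_n :=
  [set x | enorm (x - y) <= r].

(* A code C (finite subset of R^n) is given as a duplicate-free list.
   (P,N,L-1)-list-decodable: C lies in B^n(sqrt(nP)) and every ball of
   radius sqrt(nN) contains at most L-1 codewords. *)
Definition list_decodable (n : nat) (P N : R) (L : nat) (C : seq 'rV[R]_n) : Prop :=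
  uniq C /\
  (forall x, x \in C -> eball 0 (Num.sqrt (n%:R * P)) x) /\
  (forall y : 'rV[R]_n,
      (size [seq x <- C | `[< eball y (Num.sqrt (n%:R * N)) x >]] <= L - 1)%N).

Definition rate (n : nat) (C : seq 'rV[R]_n) : R := ln (size C)%:R / n%:R.

End Defs.
Arguments list_decodable {R} n P N L C.

Definition list_capacity {R : realType} (P N : R) (L : nat) : \bar R :=
  limn_esup (fun n => ereal_sup [set (rate C)%:E | C in list_decodable n P N L]).

(* Main.v *)
Require Import Defs.
From mathcomp Require Import all_boot all_order all_algebra.
From mathcomp Require Import all_classical all_reals all_analysis.
From mathcomp Require Import ring lra.
Import Order.TTheory GRing.Theory Num.Theory.
Local Open Scope ring_scope.

(* An Elias-Bassalygo argument.  Put T = L N / (L - 1) <= P.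

   Plotkin step: for b < T a ball of squared radius n b contains a number of
   codewords bounded independently of n.  Otherwise Ramsey's theorem extracts
   many codewords that are almost equidistant; being in the ball bounds their
   common distance, and then L of them lie within sqrt (n N) of their centroid.

   Averaging step: lift the code to the sphere of squared radius n P in
   R^(n+1), take Q slightly below T and let y be Gaussian with variance P - Q
   per coordinate.  With D = |x - y|^2 and l = 1 / (2 Q), the kernel
   exp (- l D) puts almost all its mass on D close to n Q, so that two Chernoff
   corrections make it nonpositive outside the window n a < D < n b, where
   a < Q < b < T.  In the window it is at most exp (- l n a) and, by the Plotkin
   step, boundedly many codewords contribute at each y; taking expectations
   gives |C| <= exp (n (ln (P / Q) / 2 + o(1))). *)

(** * Multicolour Ramsey theorem on lists *)

Lemma pigeonhole_count (T : eqType) (k W : nat) (f : T -> nat) (s : seq T) :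
  (0 < k)%N -> {in s, forall x, (f x < k)%N} -> (k * W <= size s)%N ->
  exists2 c, (c < k)%N & (W <= count (fun x => f x == c) s)%N.
Proof.
move=> k0 fk sW.
have sE : (size s = \sum_(c < k) count (fun x => f x == c) s)%N.
  elim: s fk {sW} => [|x s IH] fk /=; first by rewrite big1.
  rewrite big_split /= -IH; last by move=> y ys; rewrite fk// inE ys orbT.
  have fxk : (f x < k)%N by rewrite fk// mem_head.
  rewrite (bigD1 (Ordinal fxk))//= eqxx big1 ?addn0//.
  move=> i /negPf ne; rewrite [_ == _](_ : _ = false)//.
  by apply: contraFF ne => /eqP e; apply/eqP/val_inj.
apply: contrapT => H.
have: (size s < k * W)%N; last by rewrite ltnNge sW.
have HW c : (c < k)%N -> (count (fun x => f x == c) s < W)%N.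
  by move=> ck; rewrite ltnNge; apply/negP => ?; apply: H; exists c.
have W0 : (0 < W)%N := leq_ltn_trans (leq0n _) (HW 0%N k0).
rewrite sE (@leq_ltn_trans (\sum_(c < k) W.-1))//.
  by apply: leq_sum => c _; rewrite -ltnS prednK// HW.
by rewrite sum_nat_const card_ord ltn_pmul2l// prednK.
Qed.

(** Induction on the sum of the targets [m i]. The head of [s] is joined to many later entries in
    one colour [c]; among those, the target for [c] drops by one. A list found there in colour [c]
    is extended by the head, one in another colour is already complete. *)
Lemma ramsey_pairwise (k : nat) (m : nat -> nat) : (0 < k)%N ->
  exists M : nat, forall (T : eqType) (col : T -> T -> nat) (s : seq T),
    {in s &, forall x y, (col x y < k)%N} -> (M <= size s)%N ->
    exists c t, [/\ (c < k)%N, subseq t s, size t = m c &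
                    pairwise (fun x y => col x y == c) t].
Proof.
move=> k0; have [N] := ubnP (\sum_(i < k) m i)%N.
elim: N m => // N IH m mN.
have [[c ck c0]|mpos] := pselect (exists2 c, (c < k)%N & m c = 0%N).
  by exists 0%N => T col s _ _; exists c, [::]; rewrite sub0seq c0.
pose dec (i j : nat) := if j == i then (m i).-1 else m j.
have Hdec (i : 'I_k) : (\sum_(j < k) dec i j < N)%N.
  have mi : (0 < m i)%N.
    by rewrite lt0n; apply/negP => /eqP e; apply: mpos; exists (i : nat).
  move: mN; rewrite ltnS; apply: leq_trans.
  rewrite (bigD1 i)//= [X in (_ < X)%N](bigD1 i)//= /dec eqxx -addSn prednK//.
  by rewrite leq_add2l; apply: leq_sum => j /negPf ji; rewrite [_ == _]ji.
have /choice[MM HMM] := fun i => IH _ (Hdec i).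
pose W := (\max_(i < k) MM i)%N.
exists (k * W).+1 => T col [//|x s] colk; rewrite /= ltnS => sW.
have [c ck cW] : exists2 c, (c < k)%N & (W <= count (fun y => col x y == c) s)%N.
  apply: pigeonhole_count => // y ys; apply: colk; first exact: mem_head.
  by rewrite inE ys orbT.
pose s' := [seq y <- s | col x y == c].
have s's : subseq s' s := filter_subseq _ _.
have [||c' [t [c'k ts' st pt]]] := HMM (Ordinal ck) T col s'.
- move=> y z; rewrite !mem_filter => /andP[_ ys] /andP[_ zs].
  by apply: colk; rewrite inE ?ys ?zs orbT.
- by rewrite size_filter (leq_trans _ cW)// (leq_bigmax (Ordinal ck)).
have tss : subseq t s := subseq_trans ts' s's.
move: st; rewrite /dec/=; case: eqP => [c'c|_] st; last first.
  by exists c', t; split => //; exact: subseq_trans tss (subseq_cons _ _).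
move: c'c pt st => -> pt st; exists c, (x :: t); split => //=.
- by rewrite eqxx.
- by rewrite st prednK// lt0n; apply/negP => /eqP e; apply: mpos; exists c.
rewrite pt andbT; apply/allP => y /(mem_subseq ts').
by rewrite mem_filter => /andP[].
Qed.

(** * Squared distances and centroids *)

Section Sqn.
Context {R : realType}.

Definition sqn {n : nat} (x : 'rV[R]_n) : R := \sum_(i < n) x 0 i ^+ 2.

Lemma sqn_ge0 n (x : 'rV[R]_n) : 0 <= sqn x.
Proof. by apply: sumr_ge0 => i _; exact: sqr_ge0. Qed.

Lemma sqnB n (x y : 'rV[R]_n) : sqn (x - y) = sqn (y - x).
Proof. by apply: eq_bigr => i _; rewrite !mxE; ring. Qed.

Lemma eball_sqrtE n (y x : 'rV[R]_n) (r : R) : 0 <= r ->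
  eball y (Num.sqrt r) x = (sqn (x - y) <= r).
Proof. by move=> r0; rewrite /eball/= /enorm ler_sqrt. Qed.

Definition centroid {n K : nat} (z : 'I_K -> 'rV[R]_n) : 'rV[R]_n :=
  K%:R^-1 *: \sum_j z j.

(** Parallel axis identity, coordinate by coordinate: the cross terms cancel because deviations from
    the centroid sum to zero. *)
Lemma sum_sqn_centroid n K (z : 'I_K -> 'rV[R]_n) (p : 'rV[R]_n) : (0 < K)%N ->
  \sum_j sqn (z j - p) =
  \sum_j sqn (z j - centroid z) + K%:R * sqn (p - centroid z).
Proof.
move=> K0; rewrite /sqn exchange_big [in RHS]exchange_big mulr_sumr -big_split.
apply: eq_bigr => i _ /=.
pose a j := z j 0 i; set g := centroid z 0 i.
have Kg : \sum_j a j = K%:R * g.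
  rewrite /g mxE summxE mulrA mulfV ?mul1r//.
  by rewrite pnatr_eq0 -lt0n.
transitivity (\sum_j (a j - p 0 i) ^+ 2).
  by apply: eq_bigr => j _; rewrite !mxE.
transitivity (\sum_j ((a j - g) ^+ 2 + (2 * (g - p 0 i) * a j + (p 0 i ^+ 2 - g ^+ 2)))).
  by apply: eq_bigr => j _; ring.
rewrite big_split/= [in X in _ + X]big_split/= -mulr_sumr Kg sumr_const card_ord.
congr (_ + _); first by apply: eq_bigr => j _; rewrite [in RHS]mxE [X in _ = (_ + X) ^+ 2]mxE.
by rewrite -[X in _ + X]mulr_natl [X in _ = _ * X ^+ 2]mxE [X in _ = _ * (_ + X) ^+ 2]mxE -/g; ring.
Qed.

Lemma sum_sum_sqn n K (z : 'I_K -> 'rV[R]_n) : (0 < K)%N ->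
  \sum_i \sum_j sqn (z j - z i) = 2 * K%:R * \sum_j sqn (z j - centroid z).
Proof.
move=> K0; under eq_bigr do rewrite sum_sqn_centroid//.
rewrite big_split/= sumr_const card_ord -mulr_sumr -[X in X + _]mulr_natl; ring.
Qed.

Lemma sum_offdiag_ge n K (z : 'I_K -> 'rV[R]_n) (d : R) i :
  (forall i j, i != j -> d <= sqn (z i - z j)) ->
  (K%:R - 1) * d <= \sum_j sqn (z j - z i).
Proof.
move=> H; rewrite (bigD1 i)//= -[leLHS]add0r lerD ?sqn_ge0//.
rewrite (@le_trans _ _ (\sum_(j < K | j != i) d)) ?ler_sum//; last first.
  by move=> j ji; exact: H.
rewrite sumr_const -[X in _ <= X]mulr_natl; have -> : #|[pred j | j != i]| = K.-1.
  by have := cardC1 i; rewrite card_ord => <-; apply: eq_card => j; rewrite !inE.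
by rewrite -subn1 natrB//; case: K i {z H} => [[]|].
Qed.

(** The squared distances over ordered pairs total at least K (K - 1) d and equal 2 K times the
    scatter about the centroid, which is minimal over all centres and hence at most K r. *)
Lemma pairwise_dist_in_ball n K (z : 'I_K -> 'rV[R]_n) (p : 'rV[R]_n) (d r : R) :
  (0 < K)%N -> (forall i j, i != j -> d <= sqn (z i - z j)) ->
  (forall i, sqn (z i - p) <= r) -> (K%:R - 1) * d <= 2 * K%:R * r.
Proof.
move=> K0 Hd Hr; have k0 : 0 < K%:R :> R by rewrite ltr0n.
rewrite -(ler_pM2l k0).
have -> : K%:R * ((K%:R - 1) * d) = \sum_(i < K) ((K%:R - 1) * d).
  by rewrite sumr_const card_ord -[RHS]mulr_natl.
rewrite (@le_trans _ _ (\sum_(i < K) \sum_j sqn (z j - z i)))//.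
  by apply: ler_sum => i _; exact: sum_offdiag_ge.
rewrite sum_sum_sqn// [X in _ <= X](_ : _ = 2 * K%:R * (K%:R * r)); last by ring.
rewrite ler_wpM2l ?mulr_ge0 ?ler0n//.
have : \sum_j sqn (z j - p) <= K%:R * r.
  rewrite (@le_trans _ _ (\sum_(i < K) r))//; first by apply: ler_sum.
  by rewrite sumr_const card_ord -[X in X <= _]mulr_natl.
apply: le_trans; rewrite (sum_sqn_centroid _ _ _ p)// lerDl.
by rewrite mulr_ge0 ?ler0n ?sqn_ge0.
Qed.

(** Parallel axis identity centred at z_i: L |z_i - g|^2 is the sum of the squared distances from
    z_i, at most (L - 1) e, minus the scatter about the centroid g, at least (L - 1) d / 2. *)
Lemma centroid_dist_le n L (z : 'I_L -> 'rV[R]_n) (d e : R) i :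
  (forall i j, i != j -> d <= sqn (z i - z j) <= e) ->
  L%:R * sqn (z i - centroid z) <= (L%:R - 1) * (e - d / 2).
Proof.
move=> H; have L0 : (0 < L)%N by case: L i {z H} => [[]|].
have l0 : 0 < L%:R :> R by rewrite ltr0n.
have V : (L%:R - 1) * d <= 2 * \sum_j sqn (z j - centroid z).
  rewrite -(ler_pM2l l0) [X in _ <= X]mulrA [X in _ <= X * _]mulrC -sum_sum_sqn//.
  rewrite (_ : L%:R * ((L%:R - 1) * d) = \sum_(i < L) ((L%:R - 1) * d)).
    apply: ler_sum => j _; apply: sum_offdiag_ge => a b ab.
    by have /andP[] := H _ _ ab.
  by rewrite sumr_const card_ord -[RHS]mulr_natl.
have U : \sum_j sqn (z j - z i) <= (L%:R - 1) * e.
  rewrite (bigD1 i)//= subrr [sqn 0]big1 ?add0r; last first.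
    by move=> k _; rewrite mxE expr0n.
  rewrite (@le_trans _ _ (\sum_(j < L | j != i) e)) ?ler_sum//.
    by move=> j ji; have /andP[] := H _ _ ji.
  rewrite sumr_const -[X in X <= _]mulr_natl; have -> : #|[pred j | j != i]| = L.-1.
    by have := cardC1 i; rewrite card_ord => <-; apply: eq_card => j; rewrite !inE.
  by rewrite -subn1 natrB.
move: U; rewrite sum_sqn_centroid//; lra.
Qed.

End Sqn.

(** * Plotkin bound for codewords in a small ball *)

Section Plotkin.
Context {R : realType}.

Lemma sqn_triangle n (x x' y : 'rV[R]_n) :
  sqn (x - x') <= 2 * sqn (x - y) + 2 * sqn (x' - y).
Proof.
rewrite /sqn !mulr_sumr -big_split; apply: ler_sum => i _ /=; rewrite !mxE.
by have := sqr_ge0 (x 0 i + x' 0 i - 2 * y 0 i); lra.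
Qed.

Lemma list_decodable_ball_bound (L : nat) (N b : R) :
  (2 <= L)%N -> 0 < N -> 0 <= b -> (L%:R - 1) * b < L%:R * N ->
  exists M : nat, forall (n : nat) (P : R) (C : seq 'rV[R]_n) (y : 'rV[R]_n),
    (0 < n)%N -> list_decodable n P N L C ->
    (size [seq x <- C | (sqn (x - y) <= n%:R * b)%R] <= M)%N.
Proof.
move=> L2 N0 b0 bN.
have l2 : 2 <= L%:R :> R by rewrite ler_nat.
have l1 : 0 < L%:R - 1 :> R by lra.
(* Slack per dimension: half of it pays for [K] being finite, half for the spread of the almost
   equal distances. *)
pose g := (L%:R * N - (L%:R - 1) * b) / (L%:R - 1).
have g0 : 0 < g by rewrite divr_gt0// subr_gt0.
have gE : (L%:R - 1) * (b + g) = L%:R * N by rewrite /g; field; rewrite gt_eqF.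
(* Large enough that the factor K / (K - 1) in the bound on d / 2 costs at most n g / 2; adding [L]
   leaves room to pick L of the K points. *)
pose K := ((Num.truncn (2 * b / g)).+1 + L)%N.
have LK : (L <= K)%N by rewrite leq_addl.
have K0 : (0 < K)%N by [].
have bg0 : 0 <= 2 * b / g by rewrite divr_ge0 ?(ltW g0)// mulr_ge0.
have KE : 2 * b <= g * (K%:R - 1).
  rewrite [X in _ <= X]mulrC -ler_pdivrMr// /K natrD.
  by have /andP[_] := truncn_itv bg0; lra.
have k1 : 0 < K%:R - 1 :> R.
  by rewrite /K natrD -natr1; have := ler0n R (Num.truncn (2 * b / g)); lra.
(* Squared distances in the ball are at most 4 n b; rounded down in units of n g / 2 they give [k]
   colours, a number independent of n. *)
pose k := (Num.truncn (4 * b / (g / 2))).+1.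
have [M HM] := @ramsey_pairwise k (fun=> K) (ltn0Sn _).
exists M => n P C y n0 [Cu [_ CL]].
have n0' : 0 < n%:R :> R by rewrite ltr0n.
rewrite leqNgt; apply/negP => Msz.
set s := [seq x <- C | _] in Msz.
have ng0 : 0 < n%:R * (g / 2) by rewrite mulr_gt0// divr_gt0.
pose col (x x' : 'rV[R]_n) := Num.truncn (sqn (x - x') / (n%:R * (g / 2))).
have colk : {in s &, forall x x', (col x x' < k)%N}.
  move=> x x'; rewrite !mem_filter => /andP[xy _] /andP[x'y _].
  rewrite ltnS /col; apply: le_truncn; rewrite ler_pdivrMr//.
  rewrite [X in _ <= X](_ : _ = 4 * (n%:R * b)); last by field; rewrite gt_eqF.
  by have := sqn_triangle _ x x' y; lra.
have [c [t [_ ts tK]]] := HM _ col s colk (ltnW Msz).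
have tu : uniq t by apply: (subseq_uniq ts); exact: filter_uniq.
move=> /(pairwiseP 0) tc.
pose z (i : 'I_K) : 'rV[R]_n := nth 0 t i.
pose d := c%:R * (n%:R * (g / 2)).
have zd i j : i != j -> d <= sqn (z i - z j) <= d + n%:R * (g / 2).
  wlog ij : i j / (i < j)%N => [W ne|_].
    case: (ltngtP i j) => [ij|ij|/val_inj/eqP]; first exact: W.
      by rewrite sqnB; apply: W => //; rewrite eq_sym.
    by rewrite (negPf ne).
  have := tc i j; rewrite !inE tK !ltn_ord => /(_ isT isT ij) /eqP cE.
  have := @truncn_itv _ (sqn (z i - z j) / (n%:R * (g / 2))).
  rewrite divr_ge0 ?sqn_ge0 ?(ltW ng0)// => /(_ isT).
  rewrite [Num.truncn _]cE ler_pdivlMr// ltr_pdivrMr// -[c.+1%:R]natr1 mulrDl mul1r.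
  by move=> /andP[h1 h2]; apply/andP; split; last exact: ltW.
have zs i : z i \in s by apply: (mem_subseq ts); rewrite mem_nth ?tK.
have zy i : sqn (z i - y) <= n%:R * b.
  by have := zs i; rewrite mem_filter => /andP[].
have dK : (K%:R - 1) * d <= 2 * K%:R * (n%:R * b).
  by apply: pairwise_dist_in_ball zy => // i j ij; have /andP[] := zd _ _ ij.
have dle : d / 2 <= n%:R * b + n%:R * (g / 2).
  rewrite -(ler_pM2l k1).
  have : n%:R * (2 * b) <= n%:R * (g * (K%:R - 1)) by rewrite ler_pM2l.
  by lra.
pose w (i : 'I_L) := z (widen_ord LK i).
have wg i : sqn (w i - centroid w) <= n%:R * N.
  have l0 : 0 < L%:R :> R by lra.
  rewrite -(ler_pM2l l0).
  (* Here e - d / 2 = d / 2 + n g / 2 <= n (b + g), and (L - 1) (b + g) = L N. *)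
  apply: (le_trans (centroid_dist_le _ _ w d (d + n%:R * (g / 2)) i _)).
    move=> i1 i2 ne; apply: zd; apply: contra ne.
    by move=> /eqP/(congr1 val)/= e; apply/eqP/val_inj.
  rewrite [X in _ <= X]mulrCA -gE [X in _ <= X]mulrCA ler_pM2l//; lra.
have := CL (centroid w); rewrite leqNgt => /negP; apply.
pose u := [seq w i | i <- enum 'I_L].
have uu : uniq u.
  rewrite map_inj_uniq ?enum_uniq// => i j.
  move/eqP; rewrite /w /z nth_uniq ?tK//; try exact: ltn_ord (widen_ord LK _).
  by move=> /eqP e; exact: val_inj.
have su : size u = L by rewrite size_map size_enum_ord.
rewrite subn1 prednK; last by apply: leq_trans L2.
rewrite -[X in (X <= _)%N]su; apply: uniq_leq_size => // x /mapP[i _ ->].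
rewrite mem_filter; apply/andP; split; last first.
  by have := zs (widen_ord LK i); rewrite mem_filter => /andP[].
by apply/asboolP; rewrite eball_sqrtE// mulr_ge0 ?ler0n// ltW.
Qed.
End Plotkin.

(** * Gaussian integrals *)

Section Gauss.
Context {R : realType}.

Lemma normal_mixture_le0 (T : Type) (r : seq T) (d m s : T -> R) :
  (forall y, \sum_(j <- r) d j * normal_pdf (m j) (s j) y <= 0) ->
  \sum_(j <- r) d j <= 0.
Proof.
move=> H; rewrite -lee_fin.
pose f j x := ((d j)%:E * (normal_pdf (m j) (s j) x)%:E)%E.
have fi j : (@lebesgue_measure R).-integrable setT (f j).
  by apply: integrableZl => //; exact: integrable_normal_pdf.
have -> : (\sum_(j <- r) d j)%:E =
    (\int[@lebesgue_measure R]_x (\sum_(j <- r) f j x))%E.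
  rewrite integral_sum// -sumEFin; apply: eq_bigr => j _.
  rewrite integralZl//; last exact: integrable_normal_pdf.
  by rewrite integral_normal_pdf mule1.
rewrite -[X in (_ <= X)%E](@integral0 _ _ R (@lebesgue_measure R) setT).
apply: le_integral => //; first exact: integrable_sum.
- exact: integrable0.
- by move=> x _; rewrite sumEFin lee_fin; exact: H.
Qed.

(** One coordinate is integrated out at a time, the last one first, so that only one-dimensional
    Lebesgue integrals occur. *)
Lemma normal_product_mixture_le0 (T : Type) (r : seq T) (n : nat)
    (d : T -> R) (m : T -> nat -> R) (s : T -> R) :
  (forall y : nat -> R,
     \sum_(j <- r) d j * \prod_(i < n) normal_pdf (m j i) (s j) (y i) <= 0) ->
  \sum_(j <- r) d j <= 0.
Proof.
elim: n d => [|n IH] d H.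
  by have := H (fun=> 0); under eq_bigr do rewrite big_ord0 mulr1.
apply: IH => y.
apply: (@normal_mixture_le0 _ _ _ (fun j => m j n) s) => t.
have := H (fun i => if (i < n)%N then y i else t).
under eq_bigr => j _ do rewrite big_ord_recr/= ltnn mulrA.
by under eq_bigr => j _ do under eq_bigr => i _ do rewrite ltn_ord.
Qed.

(** Completing the square in y. The factor before the density on the right is the expectation of the
    kernel for y centred normal of variance [s2]. *)
Lemma gauss_quadraticE (l s2 x y : R) : 0 < s2 -> 0 < 1 + 2 * l * s2 ->
  expR (- l * (x - y) ^+ 2) * normal_pdf 0 (Num.sqrt s2) y =
  (Num.sqrt (1 + 2 * l * s2))^-1 * expR (- l * x ^+ 2 / (1 + 2 * l * s2)) *
  normal_pdf (2 * l * s2 * x / (1 + 2 * l * s2))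
             (Num.sqrt (s2 / (1 + 2 * l * s2))) y.
Proof.
move=> s20 t0; set t := 1 + _ in t0 *.
have st0 : 0 < s2 / t by rewrite divr_gt0.
rewrite !normal_pdfE ?gt_eqF ?sqrtr_gt0//.
rewrite /normal_peak /normal_fun !sqr_sqrtr ?ltW//.
rewrite mulrCA -expRD [RHS]mulrACA -expRD; congr (_ * expR _).
  move: (@pi R) => p; rewrite -invfM -sqrtrM ?(ltW t0)// mulrnAr.
  by rewrite [t * (s2 / t * _)]mulrA [t * (s2 / t)]mulrCA mulfV ?gt_eqF// mulr1.
rewrite /t; field.
by rewrite -/t !gt_eqF.
Qed.

End Gauss.

(** * Averaging a windowed kernel over a Gaussian centre *)

Section Count.
Context {R : realType}.

Definition sqdist (m : nat) (x y : nat -> R) : R := \sum_(i < m) (x i - y i) ^+ 2.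

(** Expectation of exp (- l |x - y|^2) for y with [m] independent centred normal coordinates of
    variance [s2] and |x|^2 = A. It depends on x only through A, hence the lift of the code to a
    sphere. *)
Definition gauss_mass (m : nat) (s2 A l : R) : R :=
  (Num.sqrt (1 + 2 * l * s2))^-1 ^+ m * expR (- l * A / (1 + 2 * l * s2)).

Lemma gauss_quadratic_prodE m (l s2 : R) (x y : nat -> R) :
  0 < s2 -> 0 < 1 + 2 * l * s2 ->
  expR (- l * sqdist m x y) * \prod_(i < m) normal_pdf 0 (Num.sqrt s2) (y i) =
  gauss_mass m s2 (\sum_(i < m) x i ^+ 2) l *
  \prod_(i < m) normal_pdf (2 * l * s2 * x i / (1 + 2 * l * s2))
             (Num.sqrt (s2 / (1 + 2 * l * s2))) (y i).
Proof.
move=> s20 t0; rewrite /sqdist mulr_sumr expR_sum -big_split/=.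
under eq_bigr => i _ do rewrite gauss_quadraticE//.
rewrite big_split/= /gauss_mass big_split/= prodr_const card_ord.
by rewrite mulr_sumr mulr_suml expR_sum.
Qed.

(** Chernoff corrections: above [b] the term with rate l - s dominates the kernel, below [a] the
    term with rate l + s does. *)
Lemma window_le (l s a b D : R) : 0 <= l -> 0 <= s ->
  expR (- l * D) - expR (- s * b) * expR (- (l - s) * D)
    - expR (s * a) * expR (- (l + s) * D) <=
  if D <= b then expR (- l * a) else 0.
Proof.
move=> l0 s0; rewrite -!expRD.
have e1 := expR_ge0 (- s * b + - (l - s) * D).
have e2 := expR_ge0 (s * a + - (l + s) * D).
have [Db|Db] := leP D b; last first.
  suff : expR (- l * D) <= expR (- s * b + - (l - s) * D) by lra.
  by rewrite ler_expR; have := ler_wpM2l s0 (ltW Db); lra.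
have e3 := expR_ge0 (- l * a).
have [aD|Da] := leP a D.
  suff : expR (- l * D) <= expR (- l * a) by lra.
  by rewrite ler_expR; have := ler_wpM2l l0 aD; lra.
suff : expR (- l * D) <= expR (s * a + - (l + s) * D) by lra.
by rewrite ler_expR; have := ler_wpM2l s0 (ltW Da); lra.
Qed.

(** Sums [window_le] over the code and takes expectations in y, where at most [M] codewords
    contribute. As every term is a coefficient times a normal density, the expected inequality is a
    statement on the sum of the coefficients. *)
Lemma gauss_count_le (T : eqType) (C : seq T) (X : T -> nat -> R) (m M : nat)
    (A a b l s s2 : R) :
  0 < s2 -> 0 <= l -> 0 <= s -> 0 < 1 + 2 * (l - s) * s2 ->
  {in C, forall x, \sum_(i < m) X x i ^+ 2 = A} ->
  (forall y, (count (fun x => (sqdist m (X x) y <= b)%R) C <= M)%N) ->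
  (size C)%:R * (gauss_mass m s2 A l - expR (- s * b) * gauss_mass m s2 A (l - s)
    - expR (s * a) * gauss_mass m s2 A (l + s)) <= M%:R * expR (- l * a).
Proof.
move=> s20 l0 s0 ls0 XA CM.
pose k1 := l; pose k2 := l - s; pose k3 := l + s.
have t2 : 0 < 1 + 2 * k2 * s2 by [].
have ls2 : 0 <= l * s2 by rewrite mulr_ge0// ltW.
have ss2 : 0 <= s * s2 by rewrite mulr_ge0// ltW.
have t1 : 0 < 1 + 2 * k1 * s2 by rewrite /k1; lra.
have t3 : 0 < 1 + 2 * k3 * s2 by rewrite /k3; lra.
pose J k := gauss_mass m s2 A k.
(* None is the comparison Gaussian, Some (x, k, c) the term c * exp (- k * |X x - y|^2). *)
pose c2 := - expR (- s * b); pose c3 := - expR (s * a).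
pose r := None :: ([seq Some (x, k1, 1) | x <- C] ++
  ([seq Some (x, k2, c2) | x <- C] ++ [seq Some (x, k3, c3) | x <- C])).
pose d (j : option (T * R * R)) :=
  if j is Some (_, k, c) then c * J k else - (M%:R * expR (- l * a)).
pose mu (j : option (T * R * R)) i :=
  if j is Some (x, k, _) then 2 * k * s2 * X x i / (1 + 2 * k * s2) else 0.
pose sd (j : option (T * R * R)) :=
  if j is Some (_, k, _) then Num.sqrt (s2 / (1 + 2 * k * s2)) else Num.sqrt s2.
suff : \sum_(j <- r) d j <= 0.
  have S c k : \sum_(x <- C) c * J k = (size C)%:R * (c * J k).
    by rewrite big_const_seq count_predT iter_addr_0 mulr_natl.
  rewrite /r big_cons !big_cat !big_map/= !S /c2 /c3 /k1 /k2 /k3 /J; lra.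
apply: (@normal_product_mixture_le0 _ _ _ m _ mu sd) => y.
rewrite /r big_cons !big_cat !big_map/=.
set W := \prod_(i < m) normal_pdf 0 _ _.
have W0 : 0 <= W by apply: prodr_ge0 => i _; exact: normal_pdf_ge0.
(* Undoes the completed square, so that the centred density [W] is a common factor. *)
have E k c : 0 < 1 + 2 * k * s2 -> \sum_(x <- C) c * J k *
     \prod_(i < m) normal_pdf (2 * k * s2 * X x i / (1 + 2 * k * s2))
      (Num.sqrt (s2 / (1 + 2 * k * s2))) (y i) =
     \sum_(x <- C) c * expR (- k * sqdist m (X x) y) * W.
  move=> k0; apply: eq_big_seq => x xC.
  by rewrite -[RHS]mulrA gauss_quadratic_prodE// XA// mulrA.
rewrite !E// -!big_split/= mulNr addrC subr_le0.
rewrite (@le_trans _ _ (\sum_(x <- C)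
  (if sqdist m (X x) y <= b then expR (- l * a) else 0) * W))//.
  apply: ler_sum => x _; rewrite -!mulrDl ler_wpM2r//.
  by have := window_le _ _ a b (sqdist m (X x) y) l0 s0; rewrite /c2 /c3 /k1 /k2 /k3; lra.
rewrite -mulr_suml ler_wpM2r// -big_mkcond/= big_const_seq iter_addr_0 -[X in X <= _]mulr_natl.
by rewrite ler_wpM2r ?expR_ge0// ler_nat.
Qed.

Lemma gauss_mass_gt0 m (s2 A l : R) : 0 < 1 + 2 * l * s2 -> 0 < gauss_mass m s2 A l.
Proof. by move=> t0; rewrite mulr_gt0 ?expR_gt0// exprn_gt0// invr_gt0 sqrtr_gt0. Qed.

Lemma invr_sqrt_le_expR (u : R) : u < 1 ->
  (Num.sqrt (1 - u))^-1 <= expR (u / (2 * (1 - u))).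
Proof.
move=> u1; have v0 : 0 < 1 - u by lra.
have E : (1 - u)^-1 <= expR (u / (2 * (1 - u))) ^+ 2.
  rewrite expr2 -expRD.
  rewrite [X in expR X](_ : _ = u / (1 - u)); last by field; rewrite gt_eqF.
  rewrite [X in X <= _](_ : _ = 1 + u / (1 - u)); last by field; rewrite gt_eqF.
  exact: expR_ge1Dx.
rewrite -ler_sqr ?nnegrE ?expR_ge0 ?invr_ge0 ?sqrtr_ge0//.
by rewrite exprVn sqr_sqrtr ?(ltW v0).
Qed.

(** Passing from l to l - s multiplies t = 1 + 2 l s2 by 1 - u. The power of t is estimated by
    [invr_sqrt_le_expR], the exponential is computed exactly. Signs of s and u are free, which
    covers both corrections. *)
Lemma gauss_mass_shift m (s2 A l s u : R) :
  0 < 1 + 2 * l * s2 -> u < 1 -> 2 * s * s2 = u * (1 + 2 * l * s2) ->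
  gauss_mass m s2 A (l - s) <= gauss_mass m s2 A l *
    expR ((m%:R * u / 2 + A * s / (1 + 2 * l * s2) ^+ 2) / (1 - u)).
Proof.
move=> t0 u1 su; have v0 : 0 < 1 - u by lra.
set t := 1 + 2 * l * s2 in t0 su *.
have tE : 1 + 2 * (l - s) * s2 = t * (1 - u).
  by rewrite [RHS]mulrBr mulr1 [t * u]mulrC -su /t; ring.
rewrite /gauss_mass -/t tE sqrtrM ?(ltW t0)// invfM exprMn.
rewrite -!mulrA ler_wpM2l ?exprn_ge0 ?invr_ge0 ?sqrtr_ge0//.
rewrite -expRD (@le_trans _ _ (expR (u / (2 * (1 - u))) ^+ m *
   expR (- (l - s) * A * (t * (1 - u))^-1)))//.
  rewrite mulrA ler_wpM2r ?expR_ge0// lerXn2r ?nnegrE ?expR_ge0 ?invr_ge0 ?sqrtr_ge0//.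
  exact: invr_sqrt_le_expR.
rewrite -expRM_natl -expRD ler_expR le_eqVlt; apply/orP; left; apply/eqP.
have lE : l * u = s - s / t.
  have -> : u = 2 * s * s2 / t by rewrite su mulfK// gt_eqF.
  transitivity (s * (2 * l * s2) / t); first by ring.
  rewrite (_ : 2 * l * s2 = t - 1); last by rewrite /t; ring.
  by field; rewrite gt_eqF.
transitivity ((m%:R * u / 2 + A * (s - l) / t) / (1 - u)).
  by field; rewrite !gt_eqF.
transitivity ((m%:R * u / 2 + A * (s - l * u) / t - l * A / t * (1 - u)) / (1 - u)).
  by field; rewrite !gt_eqF.
by rewrite lE; field; rewrite !gt_eqF.
Qed.

End Count.

(** * Counting codewords on a sphere *)

Section Asymptotics.
Context {R : realType}.

Lemma eventually_linear_ge (c e : R) : 0 < c ->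
  exists n0 : nat, forall n, (n0 <= n)%N -> e <= n%:R * c.
Proof.
move=> c0; exists (Num.truncn (`|e| / c)).+1 => n nn.
have /andP[_ H] := @truncn_itv _ (`|e| / c) (divr_ge0 (normr_ge0 _) (ltW c0)).
rewrite (le_trans (ler_norm e))// -ler_pdivrMr// (le_trans (ltW H))//.
by rewrite ler_nat.
Qed.

Lemma mul_expR_le_quarter (j x : R) : 0 <= j -> x <= - 3 -> j * expR x <= j / 4.
Proof.
move=> j0 x3; rewrite ler_wpM2l// -[x]opprK expRN lef_pV2 ?posrE ?expR_gt0 ?ltr0n//.
by apply: (le_trans _ (expR_ge1Dx _)); lra.
Qed.

Lemma list_on_sphere_count (P Q a b : R) (M : nat) :
  0 < a -> a < Q -> Q < P -> Q < b ->
  exists n0 : nat, forall (n : nat) (T : eqType) (C : seq T) (X : T -> nat -> R),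
    (n0 <= n)%N ->
    {in C, forall x, \sum_(i < n.+1) X x i ^+ 2 = n%:R * P} ->
    (forall y, (count (fun x => (sqdist n.+1 (X x) y <= n%:R * b)%R) C <= M)%N) ->
    (size C)%:R <= 2 * M%:R *
      expR (n%:R * (1 - a / Q) / 2 + n.+1%:R * (ln (P / Q) / 2)).
Proof.
move=> a0 aQ QP Qb.
have Q0 : 0 < Q by lra.
have P0 : 0 < P by lra.
have b0 : 0 < b by lra.
(* The shift exponents are divided by 1 - u and 1 + u; these margins keep both corrections
   exponentially small. *)
have [u u0 [ub ua]] : exists2 u, 0 < u & Q < b * (1 - u) /\ a * (1 + u) < Q.
  exists (Num.min ((b - Q) / (2 * b)) ((Q - a) / (2 * a))).
    by rewrite lt_min !divr_gt0 ?subr_gt0 ?mulr_gt0.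
  set u := Num.min _ _.
  have h1 : u <= (b - Q) / (2 * b) by rewrite ge_min lexx.
  have h2 : u <= (Q - a) / (2 * a) by rewrite ge_min lexx orbT.
  by move: h1 h2; rewrite !ler_pdivlMr ?mulr_gt0//; lra.
have u1 : u < 1.
  by have : 0 < b * (1 - u) by [lra]; rewrite pmulr_rgt0//; lra.
(* This [l] makes 1 + 2 l s2 equal to P / Q and centres the weighted D near n Q; [s] is fixed by the
   relation required in [gauss_mass_shift]. *)
pose t := P / Q; pose s2 := P - Q; pose l := (2 * Q)^-1; pose s := u * t / (2 * s2).
have t0 : 0 < t by rewrite divr_gt0.
have s20 : 0 < s2 by rewrite subr_gt0.
have l0 : 0 < l by rewrite invr_gt0 mulr_gt0.
have s0 : 0 < s by apply: divr_gt0; apply: mulr_gt0.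
have tE : 1 + 2 * l * s2 = t by rewrite /l /s2 /t; field; rewrite gt_eqF.
have sE : 2 * s * s2 = u * t by rewrite /s; field; rewrite gt_eqF.
have uE : u / 2 = s * (s2 * Q / P).
  by rewrite /s /t; field; rewrite !gt_eqF.
have c1 : 0 < s * (b * (1 - u) - Q) by rewrite mulr_gt0// subr_gt0.
have c2 : 0 < s * (Q - a * (1 + u)) by rewrite mulr_gt0// subr_gt0.
(* The thresholds 4 and 6 push both correction exponents below -3, so each correction is at most J /
   4 and J / 2 survives. *)
have [n1 H1] := eventually_linear_ge _ 4 c1.
have [n2 H2] := eventually_linear_ge _ 6 c2.
exists (maxn n1 n2) => n T C X; rewrite geq_max => /andP[/H1 {}H1 /H2 {}H2] XC CM.
have ls0 : 0 < 1 + 2 * (l - s) * s2.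
  have -> : 1 + 2 * (l - s) * s2 = (1 + 2 * l * s2) - 2 * s * s2 by ring.
  by rewrite tE sE -[X in X - _]mul1r -mulrBl mulr_gt0// subr_gt0.
have := @gauss_count_le _ _ C X n.+1 M (n%:R * P) (n%:R * a) (n%:R * b) l s s2
  s20 (ltW l0) (ltW s0) ls0 XC CM.
set J := gauss_mass _ _ _ l.
have J0 : 0 < J by apply: gauss_mass_gt0; rewrite tE.
have sPE : P * s / t ^+ 2 = s * Q - u / 2.
  by rewrite uE /t /s2; field; rewrite !gt_eqF.
have nS : n.+1%:R = n%:R + 1 :> R by rewrite -natr1.
have nPE : n%:R * P * s / t ^+ 2 = n%:R * (s * Q - u / 2) by rewrite -sPE !mulrA.
have K1 : expR (- s * (n%:R * b)) * gauss_mass n.+1 s2 (n%:R * P) (l - s) <= J / 4.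
  rewrite mulrC.
  have := @gauss_mass_shift _ n.+1 s2 (n%:R * P) l s u; rewrite tE -/J.
  move=> /(_ t0 u1 sE) Jle.
  rewrite (@le_trans _ _ _ _ _ (ler_wpM2r (expR_ge0 _) Jle))//.
  rewrite -[X in X <= _]mulrA -expRD mul_expR_le_quarter ?(ltW J0)//.
  rewrite nPE nS.
  rewrite -lerBrDr ler_pdivrMr ?subr_gt0//; lra.
have K2 : expR (s * (n%:R * a)) * gauss_mass n.+1 s2 (n%:R * P) (l + s) <= J / 4.
  rewrite mulrC.
  have := @gauss_mass_shift _ n.+1 s2 (n%:R * P) l (- s) (- u); rewrite tE -/J.
  rewrite !opprK; have nu1 : - u < 1 by lra.
  have nsE : 2 * - s * s2 = - u * t by rewrite mulrN !mulNr sE.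
  move=> /(_ t0 nu1 nsE) Jle.
  rewrite (@le_trans _ _ _ _ _ (ler_wpM2r (expR_ge0 _) Jle))//.
  rewrite -[X in X <= _]mulrA -expRD mul_expR_le_quarter ?(ltW J0)//.
  rewrite [n%:R * P * - s]mulrN mulNr nPE nS -lerBrDr ler_pdivrMr ?addr_gt0//; lra.
move=> H.
(* Since l n P / t = n / 2, J is exactly t^(-(n+1)/2) exp (- n / 2). *)
have JE : J * expR (n.+1%:R * (ln t / 2) + n%:R / 2) = 1.
  rewrite /J /gauss_mass tE.
  have -> : Num.sqrt t = expR (ln t / 2).
    rewrite -[in LHS](@lnK _ t) ?posrE//.
    rewrite (_ : expR (ln t) = expR (ln t / 2) ^+ 2).
      by rewrite sqrtr_sqr ger0_norm ?expR_ge0.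
    by rewrite expr2 -expRD; congr expR; field.
  rewrite exprVn -expRM_natl expRD mulrACA mulVf ?gt_eqF ?expR_gt0// mul1r -expRD.
  rewrite [X in expR X](_ : _ = 0) ?expR0//.
  by rewrite /l /t; field; rewrite !gt_eqF.
have H' : (size C)%:R * (J / 2) <= M%:R * expR (- l * (n%:R * a)).
  apply: le_trans H; rewrite ler_wpM2l ?ler0n//; lra.
set e := expR (n.+1%:R * (ln t / 2) + n%:R / 2) in JE.
have e0 : 0 < e by exact: expR_gt0.
have -> : (size C)%:R = (size C)%:R * (J / 2) * (2 * e).
  transitivity ((size C)%:R * (J * e)); first by rewrite JE mulr1.
  by field.
apply: (le_trans (ler_wpM2r _ H')); first by rewrite mulr_ge0// ltW.
rewrite /e [X in X <= _](_ : _ = 2 * M%:R * (expR (- l * (n%:R * a)) *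
   expR (n.+1%:R * (ln t / 2) + n%:R / 2))); last by ring.
rewrite ler_wpM2l ?mulr_ge0 ?ler0n// -expRD ler_expR le_eqVlt; apply/orP; left; apply/eqP.
by rewrite /l /t; field; rewrite gt_eqF.
Qed.

End Asymptotics.

(** * Lifting to the sphere and the rate bound *)

Section Lift.
Context {R : realType}.

(** The added coordinate has index n; a function on [nat] fits the Gaussian lemmas without casts
    between dimensions. *)
Definition sphere_lift (n : nat) (P : R) (x : 'rV[R]_n) (i : nat) : R :=
  if insub i is Some j then x 0 j else Num.sqrt (n%:R * P - sqn x).

Lemma sphere_lift_ord n P (x : 'rV[R]_n) (i : 'I_n) : sphere_lift n P x i = x 0 i.
Proof. by rewrite /sphere_lift valK. Qed.

Lemma sphere_lift_last n P (x : 'rV[R]_n) :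
  sphere_lift n P x n = Num.sqrt (n%:R * P - sqn x).
Proof. by rewrite /sphere_lift insubF ?ltnn. Qed.

Lemma sqn_sphere_lift n P (x : 'rV[R]_n) : sqn x <= n%:R * P ->
  \sum_(i < n.+1) sphere_lift n P x i ^+ 2 = n%:R * P.
Proof.
move=> xP; rewrite big_ord_recr/= sphere_lift_last sqr_sqrtr ?subr_ge0//.
under eq_bigr => i _ do rewrite sphere_lift_ord.
by rewrite -/(sqn x); ring.
Qed.

(** Carries the Plotkin bound in R^n over to lifted codewords and centres in R^(n+1). *)
Lemma sqn_le_sqdist_lift n P (x : 'rV[R]_n) (y : nat -> R) :
  sqn (x - \row_i y i) <= sqdist n.+1 (sphere_lift n P x) y.
Proof.
rewrite /sqdist big_ord_recr/= -[X in X <= _]addr0 lerD ?sqr_ge0//.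
by apply: ler_sum => i _; rewrite sphere_lift_ord !mxE.
Qed.

Lemma list_decodable_rate (L : nat) (P N Q a : R) :
  (2 <= L)%N -> 0 < N -> 0 < a -> a < Q -> Q < P ->
  (L%:R - 1) * Q < L%:R * N ->
  exists (n0 : nat) (K : R), forall n (C : seq 'rV[R]_n), (n0 <= n)%N -> (0 < n)%N ->
    (0 < size C)%N -> list_decodable n P N L C ->
    rate C <= (1 - a / Q) / 2 + ln (P / Q) / 2 + K / n%:R.
Proof.
move=> L2 N0 a0 aQ QP QN.
have l2 : 2 <= L%:R :> R by rewrite ler_nat.
have l1 : 0 < L%:R - 1 :> R by lra.
have P0 : 0 < P by lra.
pose T := L%:R * N / (L%:R - 1).
have QT : Q < T by rewrite ltr_pdivlMr// mulrC.
pose b := (Q + T) / 2.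
have bN : (L%:R - 1) * b < L%:R * N.
  by rewrite mulrC -ltr_pdivlMr// -/T /b; lra.
have [|M HM] := list_decodable_ball_bound _ _ b L2 N0 _ bN; first by rewrite /b; lra.
have Qb : Q < b by rewrite /b; lra.
(* [M.+1] keeps the argument of the logarithm positive. *)
have [n0 Hn0] := list_on_sphere_count P Q a b M.+1 a0 aQ QP Qb.
exists n0, (ln (2 * M.+1%:R) + ln (P / Q) / 2) => n C n0n n_gt0 C0 CD.
have n0' : 0 < n%:R :> R by rewrite ltr0n.
have := Hn0 n _ C (sphere_lift n P) n0n.
have CP : {in C, forall x, \sum_(i < n.+1) sphere_lift n P x i ^+ 2 = n%:R * P}.
  move=> x xC; apply: sqn_sphere_lift; have [_ [/(_ _ xC) + _]] := CD.
  by rewrite eball_sqrtE ?mulr_ge0 ?ler0n ?(ltW P0)// subr0.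
move=> /(_ CP) H.
have {}H := H _.
have {H} : (size C)%:R <= 2 * M.+1%:R *
      expR (n%:R * (1 - a / Q) / 2 + n.+1%:R * (ln (P / Q) / 2)).
  apply: H => y; rewrite ltnW// ltnS (leq_trans _ (HM n P C (\row_i y i) n_gt0 CD))//.
  rewrite size_filter; apply: sub_count => x /=.
  exact/le_trans/sqn_le_sqdist_lift.
have m0 : 0 < 2 * M.+1%:R :> R by rewrite mulr_gt0 ?ltr0n.
rewrite -(@ler_ln _ (size C)%:R) ?posrE ?ltr0n ?mulr_gt0 ?expR_gt0//.
rewrite [ln (_ * expR _)]lnM ?posrE ?expR_gt0// expRK => H.
rewrite /rate ler_pdivrMr//; apply: (le_trans H).
rewrite le_eqVlt; apply/orP; left; apply/eqP.
by rewrite -[n.+1%:R]natr1; field; rewrite !gt_eqF//; lra.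
Qed.

End Lift.

(** * Passage to the limit superior *)

Theorem mainTheorem16 (R : realType) (L : nat) (P N : R) :
  (2 <= L)%N -> 0 < N -> 0 < P -> N / P <= (L%:R - 1) / L%:R ->
  (list_capacity P N L <= ((1 / 2) * ln ((L%:R - 1) * P / (L%:R * N)))%:E)%E.
Proof.
move=> L2 N0 P0 NP.
have l2 : 2 <= L%:R :> R by rewrite ler_nat.
have l0 : 0 < L%:R :> R by lra.
have l1 : 0 < L%:R - 1 :> R by lra.
pose T := L%:R * N / (L%:R - 1).
have T0 : 0 < T by rewrite divr_gt0 ?mulr_gt0.
have TP : T <= P.
  move: NP; rewrite ler_pdivrMr// mulrAC ler_pdivlMr// => NP.
  by rewrite ler_pdivrMr//; lra.
have -> : (L%:R - 1) * P / (L%:R * N) = P / T.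
  by rewrite /T; field; rewrite !gt_eqF.
set beta := 1 / 2 * ln (P / T).
have beta0 : 0 <= beta.
  by rewrite mulr_ge0 ?ln_ge0 ?ler_pdivlMr ?mul1r// divr_ge0.
apply/lee_addgt0Pr => e e0.
(* With Q = T r and a = Q r, the rate bound is at most beta + e: e / 4 from (1 - r) / 2, e / 4 from
   ln (P / Q) / 2, and e / 2 from K / n. *)
pose r := expR (- (e / 2)).
have r0 : 0 < r by exact: expR_gt0.
have r1 : r < 1 by rewrite /r -[X in _ < X]expR0 ltr_expR; lra.
have rge : 1 - e / 2 <= r by apply: expR_ge1Dx.
pose Q := T * r; pose a := Q * r.
have Q0 : 0 < Q by rewrite mulr_gt0.
have a0 : 0 < a by rewrite mulr_gt0.
have aQ : a < Q by rewrite -[X in _ < X]mulr1 ltr_pM2l.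
have QT : Q < T by rewrite -[X in _ < X]mulr1 ltr_pM2l.
have QP : Q < P by exact: lt_le_trans TP.
have QN : (L%:R - 1) * Q < L%:R * N.
  by rewrite mulrC -ltr_pdivlMr.
have [n0 [K HK]] := list_decodable_rate _ _ _ _ _ L2 N0 a0 aQ QP QN.
have aQE : a / Q = r by rewrite /a mulrAC mulfV ?mul1r ?gt_eqF.
have lnE : ln (P / Q) / 2 = beta + e / 4.
  rewrite /beta /Q (_ : P / (T * r) = P / T * expR (e / 2)); last first.
    by rewrite -[e / 2]opprK expRN invfM mulrA.
  have PT0 : 0 < P / T by rewrite divr_gt0.
  rewrite lnM ?posrE ?expR_gt0//.
  by rewrite expRK; field.
have [n1 Hn1] := eventually_linear_ge (e / 2) K (divr_gt0 e0 (ltr0Sn _ 1)).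
rewrite /list_capacity /limn_esup /limf_esup.
(* The infimum over tails is bounded by one tail; the 1 in the maximum keeps n positive. *)
apply: ge_ereal_inf; eexists.
  exists [set n | (maxn (maxn n0 n1) 1 <= n)%N]%classic; last by [].
  by exists (maxn (maxn n0 n1) 1).
apply: ge_ereal_sup => _ [n /= + <-].
rewrite !geq_max => /andP[/andP[n0n n1n] n_gt0].
apply: ge_ereal_sup => _ [C CD <-]; rewrite lee_fin.
(* For the empty code ln 0 = 0 by convention, so its rate is 0 and [beta0] suffices. *)
have [C0|C0] := posnP (size C).
  by rewrite /rate C0 ln0// mul0r addr_ge0// ltW.
apply: (le_trans (HK n C n0n n_gt0 C0 CD)).
rewrite aQE lnE.
have : K / n%:R <= e / 2.
  by rewrite ler_pdivrMr ?ltr0n// mulrC; exact: Hn1.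
lra.
Qed.
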